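(* There exists an isometry $\varphi(S)$ on $H^2(\mathbb D)\otimes\ell^2$ commuting with $S\otimes I_{\ell^2}$ (an isometric analytic Toeplitz operator) such that for every Hilbert space $\mathcal H$, every pair of commuting contractions $T_1,T_2\in B(\mathcal H)$, every $k\in\mathbb N$ and every $k\times k$ matrix $[p_{rs}]_k$ of polynomials in $\mathbb C[z,w]$, $$\|[p_{rs}(T_1,T_2)]_k\|\le\|[p_{rs}(S\otimes I_{\ell^2},\varphi(S))]_k\|.$$
   Context: $S$ is the unilateral shift (multiplication by $z$) on the Hardy space $H^2(\mathbb D)$; $[p_{rs}(X,Y)]_k$ is the $k\times k$ operator matrix obtained by evaluating each entry at the commuting pair $(X,Y)$. *)

(* Defs.v *)
(* mathcomp + mathcomp-analysis + real_closed complex numbers *)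
From mathcomp Require Import all_boot all_order all_algebra.
From mathcomp Require Import all_classical all_reals all_analysis.
From mathcomp Require Import complex.
Set Implicit Arguments. Unset Strict Implicit. Unset Printing Implicit Defensive.
Import Order.TTheory GRing.Theory Num.Theory.
Local Open Scope ring_scope.
Local Open Scope classical_set_scope.

Section Defs.
Variable R : realType.
Local Notation C := R[i].

(* ---------- abstract complex Hilbert spaces ---------- *)

(* norm induced by a (candidate) inner product *)
Definition ip_norm (V : lmodType C) (ip : V -> V -> C) (x : V) : R :=
  Num.sqrt (complex.Re (ip x x)).

(* ip is an inner product on V (linear in the first variable, conjugate
   symmetric, positive definite) and V is complete for the induced norm *)
Definition hilbert_inner (V : lmodType C) (ip : V -> V -> C) : Prop :=
  [/\ (forall (a : C) (x y z : V), ip (a *: x + y) z = a * ip x z + ip y z),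
      (forall x y : V, ip y x = (ip x y)^*),
      (forall x : V, 0 <= ip x x),
      (forall x : V, ip x x = 0 -> x = 0) &
      (forall u : nat -> V,
         (forall e : R, 0 < e -> exists N : nat, forall m n : nat,
             (N <= m)%N -> (N <= n)%N -> ip_norm ip (u m - u n) < e) ->
         exists l : V, forall e : R, 0 < e -> exists N : nat, forall n : nat,
             (N <= n)%N -> ip_norm ip (u n - l) < e)].

(* linear operator on V *)
Definition op_linear (V : lmodType C) (T : V -> V) : Prop :=
  forall (a : C) (x y : V), T (a *: x + y) = a *: T x + T y.

(* contraction: a linear operator of norm <= 1 *)
Definition op_contraction (V : lmodType C) (ip : V -> V -> C) (T : V -> V) : Prop :=
  op_linear T /\ forall x : V, ip_norm ip (T x) <= ip_norm ip x.

(* ---------- polynomials in C[z,w] evaluated at a pair of operators ------ *)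
(* C[z,w] is represented as {poly {poly C}}: p = \sum_i p`_i(w) z^i.
   p(A,B) x = \sum_{i,j} c_{ij} A^i B^j x  (z |-> A, w |-> B). *)
Definition peval2 (V : lmodType C) (p : {poly {poly C}}) (A B : V -> V)
  (x : V) : V :=
  \sum_(i < size p) \sum_(j < size p`_i) (p`_i)`_j *: iter i A (iter j B x).

(* norm of the k x k operator matrix [p_rs(A,B)] acting on D^k (D the domain
   of the space, V^k with the l^2-sum norm), as an extended real *)
Definition mxopnorm (V : lmodType C) (nrm : V -> R) (D : set V) (k : nat)
  (P : 'I_k -> 'I_k -> {poly {poly C}}) (A B : V -> V) : \bar R :=
  ereal_sup
    [set (Num.sqrt (\sum_(r < k) nrm (\sum_(s < k) peval2 (P r s) A B (x s)) ^+ 2))%:E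
    | x in [set x : 'I_k -> V | (forall s, D (x s)) /\
                                \sum_(s < k) nrm (x s) ^+ 2 <= 1]].

(* ---------- the model space H^2(D) (x) l^2 ---------- *)
(* H^2(D) is identified with l^2(N) via Taylor coefficients, so
   H^2(D) (x) l^2 = l^2(N x N); f (i, j) is the coefficient of z^i e_j. *)
Definition L2 := nat * nat -> C.

Definition cabs2 (z : C) : R := complex.Re z ^+ 2 + complex.Im z ^+ 2.

Definition l2sq (f : L2) : \bar R := (\esum_(ij in setT) (cabs2 (f ij))%:E)%E.

Definition l2dom : set L2 := [set f | (l2sq f < +oo)%E].

Definition l2norm (f : L2) : R := Num.sqrt (fine (l2sq f)).

(* S (x) I : multiplication by z on the H^2 factor *)
Definition shiftI (f : L2) : L2 :=
  fun ij => if ij.1 is i.+1 then f (i, ij.2) else 0.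

(* Phi is a (linear) isometry of l^2(N x N) *)
Definition l2_isometry (Phi : L2 -> L2) : Prop :=
  [/\ (forall (a : C) (f g : L2), l2dom f -> l2dom g ->
         Phi (a *: f + g) = a *: Phi f + Phi g),
      (forall f, l2dom f -> l2dom (Phi f)) &
      (forall f, l2dom f -> l2norm (Phi f) = l2norm f)].

End Defs.

(* Main.v *)
Require Import Defs.
From mathcomp Require Import all_boot all_order all_algebra.
From mathcomp Require Import all_classical all_reals all_analysis.
From mathcomp Require Import complex.
From mathcomp Require Import ring lra zify.
Set Implicit Arguments. Unset Strict Implicit. Unset Printing Implicit Defensive.
Import Order.TTheory GRing.Theory Num.Theory.
Local Open Scope ring_scope.
Local Open Scope classical_set_scope.

(* With l^2 = H^2 one may take phi(S) = I (x) S, so that (S (x) I, phi(S)) is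
   the pair of coordinate shifts on H^2 of the bidisk. By Ando's theorem T1, T2
   dilate to commuting isometries V1, V2; if y_s is the image of x_s, the array
   V1^u V2^v y_s has a Gram matrix invariant under translation of (u, v).
   Feeding a large (M + d) x (M + d) window of this array into the scalar
   inequality for the coordinate shifts (tensored with a Hilbert space through
   a Gram factorization) gives
   M^2 |P(T)x|^2 <= (M + d)^2 |P(S, phi(S))|^2 |x|^2, and M tends to infinity.
   Only finite windows matter, so the dilation is built on spaces with a
   positive semidefinite form, without completeness, adjoints or square roots:
   the defect space of T is V itself with the form <x, y> - <Tx, Ty>. *)

(** * Linear maps between modules *)

Definition linear_map (C : pzRingType) (U W : lmodType C) (T : U -> W) :=
  forall (a : C) x y, T (a *: x + y) = a *: T x + T y.

Section LinearMap.
Variables (C : pzRingType).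
Implicit Types U W : lmodType C.

Lemma linear_mapD U W (T : U -> W) : linear_map T -> {morph T : x y / x + y}.
Proof. by move=> lT x y; have := lT 1 x y; rewrite !scale1r. Qed.

Lemma linear_map0 U W (T : U -> W) : linear_map T -> T 0 = 0.
Proof. by move=> lT; apply: (addrI (T 0)); rewrite -linear_mapD // !addr0. Qed.

Lemma linear_mapZ U W (T : U -> W) a x : linear_map T -> T (a *: x) = a *: T x.
Proof. by move=> lT; rewrite -[a *: x]addr0 lT linear_map0 // addr0. Qed.

Lemma linear_mapB U W (T : U -> W) : linear_map T -> {morph T : x y / x - y}.
Proof. by move=> lT x y; rewrite addrC -scaleN1r lT scaleN1r addrC. Qed.

Lemma linear_map_sum U W (T : U -> W) I (r : seq I) (F : I -> U) :
  linear_map T -> T (\sum_(i <- r) F i) = \sum_(i <- r) T (F i).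
Proof.
by move=> lT; rewrite (big_morph T (linear_mapD lT) (linear_map0 lT)).
Qed.

Lemma linear_map_comp U W W' (S : W -> W') (T : U -> W) :
  linear_map S -> linear_map T -> linear_map (S \o T).
Proof. by move=> lS lT a x y; rewrite /= lT lS. Qed.

End LinearMap.

(** * Positive semidefinite forms: null vectors, isometries, Gram matrices *)

Definition semi_inner (C : numClosedFieldType) (V : lmodType C) (f : V -> V -> C) :=
  [/\ forall a x y z, f (a *: x + y) z = a * f x z + f y z,
      forall x y, f y x = (f x y)^* &
      forall x, 0 <= f x x].

Section SemiInner.
Variables (C : numClosedFieldType) (V : lmodType C) (f : V -> V -> C).
Hypothesis hf : semi_inner f.

Lemma ipC x y : f y x = (f x y)^*. Proof. by case: hf. Qed.

Lemma ip_ge0 x : 0 <= f x x. Proof. by case: hf. Qed.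

Lemma ip_linear z : linear_map (fun x => f x z : C^o).
Proof. by case: hf => l _ _ a x y; rewrite l. Qed.

Lemma ipDl x y z : f (x + y) z = f x z + f y z.
Proof. exact: linear_mapD (ip_linear z) x y. Qed.

Lemma ipBl x y z : f (x - y) z = f x z - f y z.
Proof. exact: linear_mapB (ip_linear z) x y. Qed.

Lemma ipZl a x z : f (a *: x) z = a * f x z.
Proof. exact: (linear_mapZ a x (ip_linear z)). Qed.

Lemma ip0l z : f 0 z = 0.
Proof. exact: linear_map0 (ip_linear z). Qed.

Lemma ip_suml I (r : seq I) (F : I -> V) z :
  f (\sum_(i <- r) F i) z = \sum_(i <- r) f (F i) z.
Proof. exact: linear_map_sum (ip_linear z). Qed.

Lemma ipDr x y z : f z (x + y) = f z x + f z y.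
Proof. by rewrite ipC ipDl rmorphD /= -!ipC. Qed.

Lemma ipBr x y z : f z (x - y) = f z x - f z y.
Proof. by rewrite ipC ipBl rmorphB /= -!ipC. Qed.

Lemma ipZr a x z : f z (a *: x) = a^* * f z x.
Proof. by rewrite ipC ipZl rmorphM /= -!ipC. Qed.

Lemma ip_sumr I (r : seq I) (F : I -> V) z :
  f z (\sum_(i <- r) F i) = \sum_(i <- r) f z (F i).
Proof. by rewrite ipC ip_suml rmorph_sum; apply: eq_bigr => i _ /=; rewrite -ipC. Qed.

Lemma ip_conj x : (f x x)^* = f x x. Proof. by rewrite -ipC. Qed.

(** If [f z w] were nonzero, the square of [w + a *: z], which depends on [a] only through the real
    part of [a * f z w], would take negative values. *)
Lemma ip_null_l z w : f z z = 0 -> f z w = 0.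
Proof.
move=> z0; apply/eqP; apply: contraT => b0.
(* This [a] makes the square of [w + a *: z] equal to -1. *)
pose a := - (f w w + 1) / (2 * f z w).
have : 0 <= f (w + a *: z) (w + a *: z) by exact: ip_ge0.
have ab : a * f z w = - (f w w + 1) / 2.
  by rewrite /a; field.
have ab' : a^* * (f z w)^* = - (f w w + 1) / 2.
  rewrite -rmorphM /= ab.
  by rewrite rmorphM fmorphV rmorphN rmorphD /= ip_conj !rmorph1 rmorph_nat.
rewrite !ipDl !ipDr !ipZl !ipZr z0 (ipC z w) ab' ab.
have -> : f w w + - (f w w + 1) / 2 + (- (f w w + 1) / 2 + a * (a^* * 0)) = -1.
  by field.
by rewrite oppr_ge0 ler10.
Qed.

Lemma ip_null_r z w : f z z = 0 -> f w z = 0.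
Proof. by move=> z0; rewrite ipC ip_null_l // rmorph0. Qed.

Lemma ip_eq_null x y x' y' :
  f (x - x') (x - x') = 0 -> f (y - y') (y - y') = 0 -> f x y = f x' y'.
Proof.
move=> hx hy; apply: (@etrans _ _ (f x' y)).
  by apply/eqP; rewrite -subr_eq0 -ipBl ip_null_l.
by apply/eqP; rewrite -subr_eq0 -ipBr ip_null_r.
Qed.

Lemma null_trans x y z :
  f (x - y) (x - y) = 0 -> f (y - z) (y - z) = 0 -> f (x - z) (x - z) = 0.
Proof.
have <- : (x - y) + (y - z) = x - z by rewrite addrA subrK.
move: (x - y) (y - z) => u v hu hv.
by rewrite ipDl !ipDr hu hv (ip_null_l _ hu) (ip_null_l _ hv) !addr0.
Qed.

(* With w + w^* = |c|^2 this is unitary; it is a complex Householder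
   reflection, sending a to a - c when w = <a, c>. *)
Definition householder (c : V) (w : C) (x : V) : V := x - (f x c / w) *: c.

Lemma householder_linear c w : linear_map (householder c w).
Proof.
move=> a x y; rewrite /householder ipDl ipZl mulrDl -mulrA scalerDl opprD.
by rewrite scalerBr scalerA addrACA.
Qed.

Lemma householder_isometry c w x y : w != 0 -> w + w^* = f c c ->
  f (householder c w x) (householder c w y) = f x y.
Proof.
move=> w0 hw; have w0' : w^* != 0 by rewrite conjC_eq0.
rewrite /householder !(ipBl, ipBr, ipZl, ipZr) -hw (ipC y c).
by rewrite rmorphM fmorphV /=; field; rewrite w0 w0'.
Qed.

Lemma householderK c w : w != 0 -> w + w^* = f c c ->
  cancel (householder c w) (householder c w^*).
Proof.
move=> w0 hw x; have w0' : w^* != 0 by rewrite conjC_eq0.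
rewrite /householder ipBl ipZl -hw -addrA -opprD -scalerDl.
have -> : f x c / w + (f x c - f x c / w * (w + w^*)) / w^* = 0.
  by field; rewrite w0 w0'.
by rewrite scale0r subr0.
Qed.

(** Induction on [s]: each new pair is matched by composing with one Householder reflection, which
    fixes the images already in place. *)
Lemma isometry_extension (X : eqType) (s : seq X) (a b : X -> V) :
  (forall x y, f (a x) (a y) = f (b x) (b y)) ->
  exists G Gi : V -> V,
    [/\ linear_map G /\ linear_map Gi, cancel G Gi, cancel Gi G,
        forall x y, f (G x) (G y) = f x y &
        {in s, forall x, f (G (a x) - b x) (G (a x) - b x) = 0}].
Proof.
move=> hab; elim: s => [|x s [G [Gi [[lG lGi] GK GiK Giso Gab]]]].
  by exists id, id; split=> //; split=> ? ? ?.
pose c := G (a x) - b x; have [c0|c0] := eqVneq (f c c) 0.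
  exists G, Gi; split=> // y; rewrite inE => /orP[/eqP->|/Gab] //.
(* With this [w] the reflection subtracts exactly [c] from [G (a x)], landing on [b x]; since
   [G (a x)] and [b x] have equal squares, [w + w^* = f c c]. *)
pose w := f (G (a x)) c.
have hw : w + w^* = f c c.
  by rewrite -ipC /w /c !(ipBl, ipBr) Giso hab; ring.
have w0 : w != 0.
  by apply: contra_neq c0 => w0; rewrite -hw w0 rmorph0 addr0.
have w0' : w^* != 0 by rewrite conjC_eq0.
have hw' : w^* + w^*^* = f c c by rewrite conjCK addrC.
exists (householder c w \o G), (Gi \o householder c w^*).
split=> [|||y z|y].
- by split; apply: linear_map_comp => //; exact: householder_linear.
- by move=> y /=; rewrite (householderK w0 hw) GK.
- by move=> y /=; rewrite GiK; have := householderK w0' hw' y; rewrite conjCK.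
- by rewrite /= householder_isometry.
rewrite inE /= => /predU1P[->|ys].
  by rewrite /householder -/w divff // scale1r /c subKr subrr ip0l.
(* An earlier image [G (a y)] is orthogonal to [c]: it pairs equally with [G (a x)] and [b x],
   because it differs from [b y] by a null vector. *)
suff -> : householder c w (G (a y)) = G (a y) by exact: Gab.
rewrite /householder; suff -> : f (G (a y)) c = 0 by rewrite mul0r scale0r subr0.
rewrite ipBr Giso hab; apply/eqP; rewrite subr_eq0; apply/eqP/esym.
by apply: ip_eq_null; rewrite ?Gab // subrr ip0l.
Qed.

(** Gram-Schmidt elimination: one column of [B] records the components along [y x], and induction
    factors the Gram matrix of the residues [y']. *)
Lemma gram_factor (X : eqType) (s : seq X) (y : X -> V) :
  exists n (B : X -> nat -> C), {in s &, forall a b,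
    f (y a) (y b) = \sum_(l < n) B a l * (B b l)^*}.
Proof.
elim: s y => [|x s IHs] y; first by exists 0%N, (fun _ _ => 0).
pose q := f (y x) (y x).
(* When [q = 0], division by zero gives 0 and [y'] is [y]; nothing is lost, since [y x] is then
   orthogonal to every vector. *)
pose y' a := y a - (f (y a) (y x) / q) *: y x.
have [n [B hB]] := IHs y'.
pose B1 a l := if l is l'.+1 then (if a == x then 0 else B a l')
               else f (y a) (y x) / sqrtC q.
have q0 : 0 <= q by exact: ip_ge0.
have hx z : f (y' x) z = 0.
  rewrite /y' ipBl ipZl -/q; have [q0'|q0'] := eqVneq q 0.
    by rewrite q0' ip_null_l // mulr0 subrr.
  by rewrite divff // mul1r subrr.
have split_y a b : f (y a) (y b) =
    B1 a 0%N * (B1 b 0%N)^* + f (y' a) (y' b).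
  rewrite /= rmorphM fmorphV /= (geC0_conj (_ : 0 <= sqrtC q)) ?sqrtC_ge0 //.
  rewrite mulrACA -invfM -expr2 sqrtCK /y' !(ipBl, ipBr, ipZl, ipZr) -/q.
  rewrite (ipC (y b) (y x)) rmorphM fmorphV /= ip_conj -/q.
  have [q0'|q0'] := eqVneq q 0.
    by rewrite [f (y b) _]ip_null_r // rmorph0 !(mulr0, mul0r) !(subr0, add0r).
  by field.
exists n.+1, B1 => a b ha hb; rewrite big_ord_recl split_y; congr (_ + _) => /=.
have [ax|ax] := eqVneq a x.
  by rewrite ax hx big1 // => l _; rewrite mul0r.
have [bx|bx] := eqVneq b x.
  by rewrite bx ipC hx rmorph0 big1 // => l _; rewrite mulr0.
move: ha hb; rewrite !inE (negPf ax) (negPf bx) /= => ha hb; exact: hB.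
Qed.

(** Exchanges the square of a vector for a sum of scalar squares, so that an inequality for scalar
    arrays applies coordinate by coordinate. *)
Lemma nsq_gram (J : finType) (X : Type) (n : nat) (c : J -> C) (g : J -> X)
    (y : X -> V) (B : X -> nat -> C) :
  (forall i j, f (y (g i)) (y (g j)) = \sum_(l < n) B (g i) l * (B (g j) l)^*) ->
  f (\sum_j c j *: y (g j)) (\sum_j c j *: y (g j)) =
    \sum_(l < n) `|\sum_j c j * B (g j) l| ^+ 2.
Proof.
move=> hB; rewrite ip_suml.
transitivity (\sum_i \sum_j \sum_(l < n)
    c i * B (g i) l * (c j * B (g j) l)^*).
  apply: eq_bigr => i _; rewrite ip_sumr; apply: eq_bigr => j _.
  rewrite ipZl ipZr hB !mulr_sumr; apply: eq_bigr => l _.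
  by rewrite rmorphM /=; ring.
under eq_bigr => i _ do rewrite exchange_big.
rewrite exchange_big; apply: eq_bigr => l _.
rewrite normCK rmorph_sum mulr_suml; apply: eq_bigr => i _.
by rewrite mulr_sumr.
Qed.

End SemiInner.

(** * Pullbacks and sums of semidefinite forms *)

Section SemiInnerConstructions.
Variable C : numClosedFieldType.

Lemma semi_inner_comp (U W : lmodType C) (g : W -> W -> C) (S : U -> W) :
  linear_map S -> semi_inner g -> semi_inner (fun x y => g (S x) (S y)).
Proof.
move=> lS hg; split=> [a x y z|x y|x]; last by exact: ip_ge0.
  by rewrite lS (ipDl hg) (ipZl hg).
by rewrite (ipC hg).
Qed.

Lemma semi_innerD (U : lmodType C) (f g : U -> U -> C) :
  semi_inner f -> semi_inner g -> semi_inner (fun x y => f x y + g x y).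
Proof.
move=> hf hg; split=> [a x y z|x y|x].
- by rewrite (ipDl hf) (ipDl hg) (ipZl hf) (ipZl hg) mulrDr addrACA.
- by rewrite (ipC hf) (ipC hg) rmorphD.
- by rewrite addr_ge0 // ip_ge0.
Qed.

Lemma semi_inner_sum (U : lmodType C) n (f : 'I_n -> U -> U -> C) :
  (forall i, semi_inner (f i)) -> semi_inner (fun x y => \sum_i f i x y).
Proof.
move=> hf; split=> [a x y z|x y|x].
- rewrite mulr_sumr -big_split; apply: eq_bigr => i _ /=.
  by rewrite (ipDl (hf i)) (ipZl (hf i)).
- by rewrite rmorph_sum; apply: eq_bigr => i _; rewrite (ipC (hf i)).
- by apply: sumr_ge0 => i _; exact: ip_ge0.
Qed.

End SemiInnerConstructions.

(** * Ando's dilation on finite windows *)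

Section Ando.
Variables (C : numClosedFieldType) (V : lmodType C) (f : V -> V -> C).
Variables (T1 T2 : V -> V).
Hypotheses (hf : semi_inner f) (lT1 : linear_map T1) (lT2 : linear_map T2).
Hypotheses (cT1 : forall x, f (T1 x) (T1 x) <= f x x).
Hypotheses (cT2 : forall x, f (T2 x) (T2 x) <= f x x).
Hypothesis T12 : forall x, T1 (T2 x) = T2 (T1 x).

Let defect (T : V -> V) x y := f x y - f (T x) (T y).

Let semi_inner_defect T : linear_map T -> (forall x, f (T x) (T x) <= f x x) ->
  semi_inner (defect T).
Proof.
move=> lT cT; split=> [a x y z|x y|x]; last by rewrite subr_ge0.
  by rewrite /defect lT !(ipDl hf) !(ipZl hf); ring.
by rewrite /defect !(ipC hf x) (ipC hf (T x)) rmorphB.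
Qed.

Let fM (p q : V * V) := defect T1 p.1 q.1 + defect T2 p.2 q.2.

Let semi_inner_fM : semi_inner fM.
Proof.
exact: (semi_innerD
  (@semi_inner_comp C _ V (defect T1) fst _ (semi_inner_defect lT1 cT1))
  (@semi_inner_comp C _ V (defect T2) snd _ (semi_inner_defect lT2 cT2))).
Qed.

(** The dilation space: [V] followed by a stream of pairs of defect vectors. *)
Let K : lmodType C := (V * (nat -> V * V))%type.

(** Cutting the stream at [L] keeps the form finite without any summability condition; it is exact
    on streams supported below [L]. *)
Let fK L (x y : K) := f x.1 y.1 + \sum_(m < L) fM (x.2 m) (y.2 m).

Let semi_inner_fK L : semi_inner (fK L).
Proof.
apply: (semi_innerD (@semi_inner_comp C K V f fst _ hf)) => //.
apply: (@semi_inner_sum C K L (fun m x y => fM (x.2 m) (y.2 m))) => m.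
by apply: (@semi_inner_comp C K _ fM (fun x => x.2 m)).
Qed.

Section Model.
Variables (G Gi : V * V -> V * V).
Hypotheses (lG : linear_map G) (lGi : linear_map Gi) (GK : cancel G Gi)
  (GiK : cancel Gi G) (Giso : forall p q, fM (G p) (G q) = fM p q).

(* V1 = G W1 and V2 = W2 G^-1 with W1, W2 placing the defect vector h in the
   first, respectively second, coordinate of the stream and delaying that
   coordinate; V1 V2 and V2 V1 agree at (h; q) up to null vectors as soon as
   G (T2 h, h) and (h, T1 h) do. *)
Let V1q (x : K) m := (if m is m'.+1 then (x.2 m').1 else x.1, (x.2 m).2).
Let V2q (x : K) m :=
  ((Gi (x.2 m)).1, if m is m'.+1 then (Gi (x.2 m')).2 else x.1).
Let V1 (x : K) : K := (T1 x.1, fun m => G (V1q x m)).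
Let V2 (x : K) : K := (T2 x.1, V2q x).

Let supp t (x : K) := forall m, (t <= m)%N -> x.2 m = 0.

Let V1_supp t x : supp t x -> supp t.+1 (V1 x).
Proof.
move=> sx [|m] //= tm; rewrite /V1q /V2q !sx //; last exact: ltnW.
exact: (linear_map0 lG).
Qed.

Let V2_supp t x : supp t x -> supp t.+1 (V2 x).
Proof.
move=> sx [|m] //= tm; rewrite /V1q /V2q !sx // ?(linear_map0 lGi) //.
exact: ltnW.
Qed.

Let fM_sum L (p q : nat -> V * V) : \sum_(m < L) fM (p m) (q m) =
  \sum_(m < L) defect T1 (p m).1 (q m).1 +
  \sum_(m < L) defect T2 (p m).2 (q m).2.
Proof. exact: big_split. Qed.

Let defect0l T y : linear_map T -> defect T 0 y = 0.
Proof. by move=> lT; rewrite /defect (linear_map0 lT) !(ip0l hf) subrr. Qed.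

(** The delay feeds [defect T1 x.1 y.1] into the stream, making up for the loss from [f x.1 y.1] to
    [f (T1 x.1) (T1 y.1)]; entry [L], pushed beyond the cut-off, vanishes by the support
    condition. *)
Let V1_isometry L x y : supp L x -> fK L.+1 (V1 x) (V1 y) = fK L.+1 x y.
Proof.
move=> sx; rewrite /fK; under eq_bigr => m _ do rewrite Giso.
rewrite !fM_sum.
rewrite [X in _ + (X + _) = _]big_ord_recl [X in _ = _ + (X + _)]big_ord_recr /=.
rewrite sx // defect0l // addr0 !addrA; congr (_ + _ + _).
by rewrite addrAC subrr add0r.
Qed.

Let V2_isometry L x y : supp L x -> fK L.+1 (V2 x) (V2 y) = fK L.+1 x y.
Proof.
move=> sx; have iso p q : fM p q = fM (Gi p) (Gi q) by rewrite -[RHS]Giso !GiK.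
have sumE : \sum_(m < L.+1) fM (x.2 m) (y.2 m) =
    \sum_(m < L.+1) defect T1 (Gi (x.2 m)).1 (Gi (y.2 m)).1 +
    \sum_(m < L.+1) defect T2 (Gi (x.2 m)).2 (Gi (y.2 m)).2.
  rewrite -(fM_sum _ (fun m => Gi (x.2 m)) (fun m => Gi (y.2 m))).
  by apply: eq_bigr => m _; exact: iso.
rewrite /fK sumE fM_sum.
rewrite [X in _ + (_ + X) = _]big_ord_recl [X in _ = _ + (_ + X)]big_ord_recr /=.
rewrite sx // (linear_map0 lGi) defect0l // addr0 addrCA [RHS]addrCA.
congr (_ + _); rewrite addrA; congr (_ + _).
by rewrite /defect addrC /= subrK.
Qed.

(** Nullity is asked of every stream entry, so the relation does not depend on the cut-off and is
    preserved by [V1]. *)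
Let sim (x y : K) :=
  x.1 = y.1 /\ forall m, fM (x.2 m - y.2 m) (x.2 m - y.2 m) = 0.

Let sim_refl x : sim x x.
Proof. by split=> // m; rewrite subrr (ip0l semi_inner_fM). Qed.

Let sim_trans y x z : sim x y -> sim y z -> sim x z.
Proof.
move=> [xy1 xy2] [yz1 yz2]; split; first by rewrite xy1.
by move=> m; apply: (null_trans semi_inner_fM (xy2 m) (yz2 m)).
Qed.

Let fK_sim L x y x' y' : sim x x' -> sim y y' -> fK L x y = fK L x' y'.
Proof.
move=> [xx1 xx2] [yy1 yy2]; rewrite /fK xx1 yy1; congr (_ + _).
by apply: eq_bigr => m _; apply: (ip_eq_null semi_inner_fM).
Qed.

Let fM_null p : (fM p p = 0) ->
  defect T1 p.1 p.1 = 0 /\ defect T2 p.2 p.2 = 0.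
Proof.
move/eqP; rewrite paddr_eq0 ?subr_ge0 // => /andP[/eqP-> /eqP->] //.
Qed.

Let V1_sim x y : sim x y -> sim (V1 x) (V1 y).
Proof.
move=> [xy1 xy2]; split=> [|m]; first by rewrite /= xy1.
rewrite /= -(linear_mapB lG) Giso /fM /=.
have [_ -> ] := fM_null (xy2 m); rewrite addr0.
case: m => [|m]; last by have [] := fM_null (xy2 m).
by rewrite xy1 subrr /defect (linear_map0 lT1) (ip0l hf) subrr.
Qed.

Let V12_sim x :
    (let z := G (T2 x.1, x.1) - (x.1, T1 x.1) in fM z z = 0) ->
  sim (V2 (V1 x)) (V1 (V2 x)).
Proof.
move=> hx; split=> [|[|m]] /=; first by rewrite T12.
  rewrite /V2q /= !GK /= -(opprB (G _)) -scaleN1r.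
  by rewrite (ipZl semi_inner_fM) (ipZr semi_inner_fM) hx !mulr0.
(* Beyond entry 0 both products delay the whole stream by one, giving [x.2 m]. *)
rewrite /V2q /= !GK /V1q /= -!surjective_pairing GiK subrr.
by rewrite (ip0l semi_inner_fM).
Qed.

Variables (k : nat) (x : 'I_k -> V) (N : nat).
Hypothesis window : forall i j s, (i <= N)%N -> (j <= N)%N ->
  let h := iter i T1 (iter j T2 (x s)) in
  let z := G (T2 h, h) - (h, T1 h) in fM z z = 0.

Let Y i j s : K := iter i V1 (iter j V2 (x s, 0)).

Let Y_fst i j s : (Y i j s).1 = iter i T1 (iter j T2 (x s)).
Proof.
rewrite /Y; elim: i => /= [|i ->] //.
by elim: j => //= j ->.
Qed.

Let Y_supp i j s : supp (i + j) (Y i j s).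
Proof.
elim: i => [|i IHi] /=; last exact: V1_supp.
by elim: j => //= j IHj; exact: V2_supp.
Qed.

(** [V2] is moved past the copies of [V1] one at a time; each exchange takes place over a vector of
    the window. *)
Let V2_Y i j s : (i <= N)%N -> (j <= N)%N -> sim (V2 (Y i j s)) (Y i j.+1 s).
Proof.
move=> iN jN; elim: i iN => [|i IHi] iN; first exact: sim_refl.
apply: (@sim_trans (V1 (V2 (Y i j s)))).
  by apply: V12_sim; rewrite Y_fst; apply: window => //; exact: ltnW.
by apply: V1_sim; apply: IHi; exact: ltnW.
Qed.

Let Y_shift1 u i j i' j' s s' : (u + i <= N)%N -> (j <= N)%N ->
  fK (N + N).+1 (Y (u + i) j s) (Y (u + i') j' s') =
  fK (N + N).+1 (Y i j s) (Y i' j' s').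
Proof.
move=> + jN; elim: u => [|u IHu] uiN; first by rewrite !add0n.
apply: etrans (IHu (ltnW uiN)); apply: (@V1_isometry _ (Y (u + i) j s)) => m Nm.
by apply: (@Y_supp (u + i)); lia.
Qed.

Let Y_shift2 v i j i' j' s s' :
    (i <= N)%N -> (v + j <= N)%N -> (i' <= N)%N -> (v + j' <= N)%N ->
  fK (N + N).+1 (Y i (v + j) s) (Y i' (v + j') s') =
  fK (N + N).+1 (Y i j s) (Y i' j' s').
Proof.
move=> iN + i'N; elim: v => [|v IHv] vjN vj'N; first by rewrite !add0n.
apply: etrans (IHv (ltnW vjN) (ltnW vj'N)).
apply: (@etrans _ _ (fK (N + N).+1 (V2 (Y i (v + j) s)) (V2 (Y i' (v + j') s')))).
  by apply/esym; apply: fK_sim; apply: V2_Y => //; exact: ltnW.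
by apply: V2_isometry => m Nm; apply: Y_supp; lia.
Qed.

Let Y_shift u v i j i' j' s s' :
    (u + i <= N)%N -> (v + j <= N)%N -> (u + i' <= N)%N -> (v + j' <= N)%N ->
  fK (N + N).+1 (Y (u + i) (v + j) s) (Y (u + i') (v + j') s') =
  fK (N + N).+1 (Y i j s) (Y i' j' s').
Proof.
move=> uiN vjN ui'N vj'N.
by apply: etrans (Y_shift1 _ _ _ _ _ _) (Y_shift2 _ _ _ _ _ _); lia.
Qed.

Lemma ando_model : exists (F : K -> K -> C) (Z : nat -> nat -> 'I_k -> K),
  [/\ semi_inner F, forall y, f y.1 y.1 <= F y y,
      forall i j s, (Z i j s).1 = iter i T1 (iter j T2 (x s)),
      forall s, F (Z 0%N 0%N s) (Z 0%N 0%N s) = f (x s) (x s) &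
      forall u v i j i' j' s s',
        (u + i <= N)%N -> (v + j <= N)%N -> (u + i' <= N)%N -> (v + j' <= N)%N ->
        F (Z (u + i)%N (v + j)%N s) (Z (u + i')%N (v + j')%N s') =
        F (Z i j s) (Z i' j' s')].
Proof.
(* Streams over the window have length at most [N + N], one less than the cut-off, as the isometry
   lemmas require. *)
exists (fK (N + N).+1), Y; split=> [|y|i j s|s|] //.
  by rewrite lerDl sumr_ge0 // => m _; exact: ip_ge0.
rewrite /fK big1 ?addr0 // => m _; exact: (ip0l semi_inner_fM).
Qed.

End Model.

(* The dilating pair commutes only up to null vectors and only on the window of
   the T1^i T2^j (x s) with i, j <= N, because the unitary of Ando's
   construction is prescribed on finitely many vectors; this is all that
   stationarity of the Gram matrix on the window requires. *)
Lemma ando_window (k : nat) (x : 'I_k -> V) (N : nat) :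
  exists (K : lmodType C) (F : K -> K -> C) (p : K -> V)
    (Z : nat -> nat -> 'I_k -> K),
  [/\ semi_inner F /\ linear_map p, forall y, f (p y) (p y) <= F y y,
      forall i j s, p (Z i j s) = iter i T1 (iter j T2 (x s)),
      forall s, F (Z 0%N 0%N s) (Z 0%N 0%N s) = f (x s) (x s) &
      forall u v i j i' j' s s',
        (u + i <= N)%N -> (v + j <= N)%N -> (u + i' <= N)%N -> (v + j' <= N)%N ->
        F (Z (u + i)%N (v + j)%N s) (Z (u + i')%N (v + j')%N s') =
        F (Z i j s) (Z i' j' s')].
Proof.
pose w : seq V := [seq iter t.1.1 T1 (iter t.1.2 T2 (x t.2)) |
  t : 'I_N.+1 * 'I_N.+1 * 'I_k].
have [|G [Gi [[lG lGi] GK GiK Giso Gw]]] := @isometry_extension C _ fM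
  semi_inner_fM V w (fun h => (T2 h, h)) (fun h => (h, T1 h)).
  (* Ando's identity: by commutativity both sums of defects telescope to
     [f g h - f (T1 (T2 g)) (T1 (T2 h))]. *)
  by move=> g h; rewrite /fM /defect /= !T12; ring.
have [|F [Z [hF pF Zp Z0 Zshift]]] :=
    @ando_model G Gi lG lGi GK GiK Giso k x N.
  move=> i j s iN jN; apply: Gw; apply/fintype.imageP.
  by exists (Ordinal (iN : (i < N.+1)%N), Ordinal (jN : (j < N.+1)%N), s).
by exists K, F, fst, Z.
Qed.

End Ando.

(** * Transference from scalar arrays to commuting contractions *)

Lemma nsq_eq (C : numClosedFieldType) (V : lmodType C) (f : V -> V -> C)
    (J : finType) (c : J -> C) (y z : J -> V) :
  semi_inner f -> (forall i j, f (y i) (y j) = f (z i) (z j)) ->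
  f (\sum_j c j *: y j) (\sum_j c j *: y j) =
  f (\sum_j c j *: z j) (\sum_j c j *: z j).
Proof.
move=> hf yz; rewrite !(ip_suml hf); apply: eq_bigr => i _.
rewrite !(ip_sumr hf); apply: eq_bigr => j _.
by rewrite !(ipZl hf) !(ipZr hf) yz.
Qed.

Section Transference.
Variables (C : numClosedFieldType) (k d : nat).
Variables (cf : 'I_k -> 'I_k -> nat -> nat -> C) (B : C).
Local Notation index := ('I_k * 'I_d * 'I_d)%type.

(** Row [r] of the polynomial matrix at [(T1, T2)], summed over one flat index so that the Gram
    lemmas apply. *)
Definition coef_eval (V : lmodType C) (T1 T2 : V -> V) (x : 'I_k -> V) r :=
  \sum_(t : index)
    cf r t.1.1 t.1.2 t.2 *: iter t.1.2 T1 (iter t.2 T2 (x t.1.1)).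

Hypothesis scalar_bound : forall M (c : nat -> nat -> 'I_k -> C),
  \sum_(r < k) \sum_(u < M) \sum_(v < M)
    `|\sum_(t : index) cf r t.1.1 t.1.2 t.2 * c (u + t.1.2)%N (v + t.2)%N t.1.1| ^+ 2
  <= B * \sum_(u < M + d) \sum_(v < M + d) \sum_(s < k) `|c u v s| ^+ 2.

Lemma contraction_bound (V : lmodType C) (f : V -> V -> C) (T1 T2 : V -> V)
    (x : 'I_k -> V) M :
  semi_inner f -> linear_map T1 -> linear_map T2 ->
  (forall x, f (T1 x) (T1 x) <= f x x) -> (forall x, f (T2 x) (T2 x) <= f x x) ->
  (forall x, T1 (T2 x) = T2 (T1 x)) ->
  M%:R ^+ 2 *
    \sum_(r < k) f (coef_eval T1 T2 x r) (coef_eval T1 T2 x r) <=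
  (M + d)%:R ^+ 2 * (B * \sum_(s < k) f (x s) (x s)).
Proof.
move=> hf lT1 lT2 cT1 cT2 T12; set P := coef_eval T1 T2 x.
have [K [F [p [Z [[hF lp] pF pZ Z0 Zshift]]]]] :=
  ando_window hf lT1 lT2 cT1 cT2 T12 x (M + d).
pose y (t : nat * nat * 'I_k) := Z t.1.1 t.1.2 t.2.
pose w := [seq (val t.1.1, val t.1.2, t.2) |
  t : 'I_(M + d) * 'I_(M + d) * 'I_k].
have inw u v s : (u < M + d)%N -> (v < M + d)%N -> (u, v, s) \in w.
  by move=> uM vM; apply/fintype.imageP; exists (Ordinal uM, Ordinal vM, s).
have [n [G hG]] := gram_factor hF w y.
have ltMd a b : (a < M)%N -> (b < d)%N -> (a + b < M + d)%N by lia.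
(* By stationarity the translate by [(u, v)] has the same square as the untranslated combination of
   the [Z i j s], which [p] sends to [P r] without increasing the square. *)
have Pbound r (u v : 'I_M) : f (P r) (P r) <= \sum_(l < n) `|\sum_(t : index)
    cf r t.1.1 t.1.2 t.2 * G (u + t.1.2, v + t.2, t.1.1)%N l| ^+ 2.
  rewrite -(@nsq_gram _ _ _ hF _ _ n (fun t : index => cf r t.1.1 t.1.2 t.2)
    (fun t : index => (u + t.1.2, v + t.2, t.1.1)%N) y G); last first.
    by move=> i j; apply: hG; apply: inw; apply: ltMd => //; exact: ltn_ord.
  rewrite (@nsq_eq _ _ F _ _ _ (fun t : index => Z t.1.2 t.2 t.1.1) hF); last first.
    by move=> i j; apply: Zshift; apply/ltnW/ltMd => //; exact: ltn_ord.
  apply: le_trans (pF _); rewrite (linear_map_sum _ _ lp).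
  under eq_bigr => t _ do rewrite (linear_mapZ _ _ lp) pZ.
  exact: lexx.
have Zx u v s : (u < M + d)%N -> (v < M + d)%N ->
    \sum_(l < n) `|G (u, v, s) l| ^+ 2 = f (x s) (x s).
  move=> uM vM; rewrite -Z0 -(Zshift u v) ?addn0 ?(ltnW uM) ?(ltnW vM) //.
  have -> : F (Z u v s) (Z u v s) = F (y (u, v, s)) (y (u, v, s)) by [].
  rewrite hG ?inw //.
  by apply: eq_bigr => l _; rewrite normCK.
(* All [(M + d)^2] positions carry the same squares [f (x s) (x s)]. *)
have -> : (M + d)%:R ^+ 2 * (B * \sum_(s < k) f (x s) (x s)) =
    \sum_(l < n) B * \sum_(u < M + d) \sum_(v < M + d) \sum_(s < k)
      `|G (val u, val v, s) l| ^+ 2.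
  rewrite -mulr_sumr exchange_big mulrCA; congr (_ * _) => /=.
  transitivity (\sum_(u < M + d) \sum_(v < M + d) \sum_(s < k) f (x s) (x s)).
    by rewrite !sumr_const !card_ord -mulrnA -[RHS]mulr_natl natrM expr2.
  apply: eq_bigr => u _; rewrite [RHS]exchange_big; apply: eq_bigr => v _.
  rewrite [RHS]exchange_big; by apply: eq_bigr => s _; rewrite Zx // ltn_ord.
(* The scalar inequality is used once for each Gram coordinate [l]; on the left, [M^2] translations
   bound the same quantity. *)
apply: (@le_trans _ _ (\sum_(l < n) \sum_(r < k) \sum_(u < M) \sum_(v < M)
    `|\sum_(t : index)
       cf r t.1.1 t.1.2 t.2 * G (u + t.1.2, v + t.2, t.1.1)%N l| ^+ 2)); last first.
  apply: ler_sum => l _; exact: (scalar_bound M (fun u v s => G (u, v, s) l)).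
rewrite exchange_big mulr_sumr; apply: ler_sum => r _ /=.
have -> : M%:R ^+ 2 * f (P r) (P r) = \sum_(u < M) \sum_(v < M) f (P r) (P r).
  by rewrite !sumr_const !card_ord -mulrnA -[RHS]mulr_natl natrM expr2.
rewrite [leRHS]exchange_big; apply: ler_sum => u _.
rewrite [leRHS]exchange_big; apply: ler_sum => v _; exact: Pbound.
Qed.

End Transference.

(** * The coordinate shifts on the bidisk and elementary estimates *)

Section ModelSpace.
Variable R : realType.
Local Notation C := R[i].

Definition shift2 (f : L2 R) : L2 R :=
  fun ij => if ij.2 is j.+1 then f (ij.1, j) else 0.

Lemma cabs2_ge0 (z : C) : 0 <= cabs2 z.
Proof. by rewrite addr_ge0 ?sqr_ge0. Qed.

Lemma normC_cabs2 (z : C) : `|z| ^+ 2 = (cabs2 z)%:C%C.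
Proof.
by case: z => a b; rewrite normCK; apply/eqP; rewrite eq_complex /cabs2 /=;
  apply/andP; split; apply/eqP; ring.
Qed.

Lemma cabs2_0 : cabs2 (0 : C) = 0.
Proof. by rewrite /cabs2 /= expr0n addr0. Qed.

Lemma cabs2M (a b : C) : cabs2 (a * b) = cabs2 a * cabs2 b.
Proof. by case: a b => [? ?] [? ?]; rewrite /cabs2 /=; ring. Qed.

Lemma esum_supp (T : choiceType) (Q : set T) (a : T -> \bar R) :
  (forall i, ~ Q i -> a i = 0%E) ->
  (\esum_(i in setT) a i = \esum_(i in Q) a i)%E.
Proof.
move=> a0; rewrite [RHS]esum_mkcond; apply: eq_esum => i _.
by case: ifPn => // /negP; rewrite inE => /a0.
Qed.

Lemma l2sq_shift2 (f : L2 R) : l2sq (shift2 f) = l2sq f.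
Proof.
rewrite /l2sq (@esum_supp _ [set ij | (0 < ij.2)%N]); last first.
  by move=> [i [|j]] //= _; rewrite cabs2_0.
rewrite (@reindex_esum _ _ _ setT _ (fun ij => (ij.1, ij.2.+1))); last first.
  split; first by move=> [i j].
    by move=> [i j] [i' j'] _ _ [-> ->].
  by move=> [i [|j]] //= _; exists (i, j).
by apply: eq_esum => -[i j].
Qed.

Lemma shift2_isometry : l2_isometry shift2.
Proof.
split=> [a f g _ _|f|f _]; last by rewrite /l2norm l2sq_shift2.
  by apply/funext => -[i [|j]]; rewrite /shift2 !fctE /= ?scaler0 ?addr0.
by rewrite /l2dom /= l2sq_shift2.
Qed.

Lemma shift2_shiftI (f : L2 R) : shift2 (shiftI f) = shiftI (shift2 f).
Proof. by apply/funext => -[[|i] [|j]]. Qed.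

Lemma l2sq_finite L (f : L2 R) :
  (forall i j, (L <= i)%N || (L <= j)%N -> f (i, j) = 0) ->
  l2sq f = (\sum_(i < L) \sum_(j < L) cabs2 (f (val i, val j)))%:E.
Proof.
move=> f0; rewrite /l2sq (@esum_supp _ [set ij | (ij.1 < L)%N /\ (ij.2 < L)%N]).
  rewrite (@reindex_esum _ ('I_L * 'I_L)%type _ setT _
    (fun ij => (val ij.1, val ij.2))); last first.
    split; first by move=> [i j] _ /=.
      by move=> [i j] [i' j'] _ _ [/val_inj -> /val_inj ->].
    by move=> [i j] /= [iL jL]; exists (Ordinal iL, Ordinal jL).
  rewrite esum_fset; [|exact: finite_finset|by move=> i _; rewrite lee_fin cabs2_ge0].
  rewrite (fsbigE (index_enum ('I_L * 'I_L)%type)) ?index_enum_uniq //.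
    rewrite pair_bigA -sumEFin; apply: eq_bigl => i; exact: in_setT.
  by move=> i _; rewrite mem_index_enum.
move=> [i j] /= nij; rewrite f0 ?cabs2_0 //.
by apply: contra_notT nij; rewrite negb_or -!ltnNge => /andP.
Qed.

Lemma iter_shift (f : L2 R) i j a b :
  iter i (@shiftI R) (iter j shift2 f) (a, b) =
  if (i <= a)%N && (j <= b)%N then f ((a - i)%N, (b - j)%N) else 0.
Proof.
elim: i a => [|i IHi] [|a] //=; last by rewrite /shiftI /= IHi subSS.
  by elim: j b => [|j IHj] [|b] //=; rewrite /shift2 /= IHj subSS.
by elim: j b => [|j IHj] [|b] //=; rewrite /shift2 /= IHj subSS.
Qed.

Lemma peval2_widen (V : lmodType C) (p : {poly {poly C}}) (A B : V -> V) (x : V)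
    d : (size p <= d)%N -> (forall i, (size (p`_i)%R <= d)%N) ->
  peval2 p A B x =
  \sum_(i < d) \sum_(j < d) (p`_i)`_j *: iter i A (iter j B x).
Proof.
move=> pd pid; rewrite /peval2.
have inner i : \sum_(j < size (p`_i)%R) (p`_i)`_j *: iter i A (iter j B x) =
    \sum_(j < d) (p`_i)`_j *: iter i A (iter j B x).
  rewrite (big_ord_widen d (fun j => (p`_i)`_j *: iter i A (iter j B x))) //.
  rewrite big_mkcond; apply: eq_bigr => j _; case: ltnP => // pj.
  by rewrite nth_default // scale0r.
under eq_bigr => i _ do rewrite inner.
rewrite (big_ord_widen d
  (fun i => \sum_(j < d) (p`_i)`_j *: iter i A (iter j B x))) //.
rewrite big_mkcond; apply: eq_bigr => i _; case: ltnP => // pj.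
by rewrite nth_default // big1 // => j _; rewrite coef0 scale0r.
Qed.

Lemma sum_triple (V : nmodType) (I J K : finType) (F : I -> J -> K -> V) :
  \sum_(t : I * J * K) F t.1.1 t.1.2 t.2 = \sum_i \sum_j \sum_k F i j k.
Proof. by rewrite pair_bigA /= pair_bigA. Qed.

Lemma sum_rev_le (F : nat -> R) M N L : (M <= N <= L)%N -> (forall i, 0 <= F i) ->
  \sum_(i < M) F (N - i.+1)%N <= \sum_(i < L) F i.
Proof.
move=> /andP[MN NL] F0.
have widen m n (G : nat -> R) : (m <= n)%N -> (forall i, 0 <= G i) ->
    \sum_(i < m) G i <= \sum_(i < n) G i.
  move=> mn G0; rewrite (big_ord_widen n G mn) big_mkcond.
  by apply: ler_sum => i _; case: ifP.
apply: (@le_trans _ _ (\sum_(i < N) F (N - i.+1)%N)).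
  exact: (widen _ _ (fun i => F (N - i.+1)%N)).
rewrite (reindex_inj rev_ord_inj) /=.
apply: le_trans (widen _ _ _ NL F0); apply: ler_sum => i _.
by rewrite subnSK // subKn // ltnW.
Qed.

(** The ratio of [(M + d)^2] to [M^2] tends to 1; if [Z < X], one explicit large [M] gives a
    contradiction. *)
Lemma growth_limit (X Z : R) d : 0 <= Z ->
  (forall M : nat, M%:R ^+ 2 * X <= (M + d)%:R ^+ 2 * Z) -> X <= Z.
Proof.
move=> Z0 h; rewrite leNgt; apply/negP => ZX.
have XZ : 0 < X - Z by rewrite subr_gt0.
(* The 3 comes from [2 * M * d + d^2 <= 3 * M * d] for [d <= M], with [M] taken to be
   [m + d + 1]. *)
pose m := Num.bound (3 * d%:R * Z / (X - Z)).
have := archi_boundP (_ : 0 <= 3 * d%:R * Z / (X - Z)).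
rewrite -/m divr_ge0 ?mulr_ge0 ?ler0n // ?(ltW XZ) // => /(_ isT).
rewrite ltr_pdivrMr // => hm.
clearbody m; have := h (m + d).+1.
rewrite natrD -natr1 natrD.
have := ler0n R m; have := ler0n R d.
move: (m%:R : R) (d%:R : R) hm => a b hm b0 a0.
set M := a + b + 1 => hM.
have M0 : 0 < M by rewrite /M; lra.
have bM : b * (b * Z) <= M * (b * Z).
  by apply: ler_wpM2r; [rewrite mulr_ge0 | rewrite /M; lra].
have aM : M * (a * (X - Z)) <= M * (M * (X - Z)).
  by apply: ler_wpM2l; [exact: ltW | apply: ler_wpM2r; [exact: ltW | rewrite /M; lra]].
have : M * (3 * b * Z) < M * (a * (X - Z)) by rewrite ltr_pM2l.
by move: hM bM aM; clearbody M; rewrite !expr2; lra.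
Qed.

End ModelSpace.

(** * The scalar inequality extracted from the norm of the shift matrix *)

Section ScalarBound.
Variable R : realType.
Local Notation C := R[i].

Lemma l2norm_finite L (f : L2 R) :
  (forall i j, (L <= i)%N || (L <= j)%N -> f (i, j) = 0) ->
  l2dom f /\
  l2norm f ^+ 2 = \sum_(i < L) \sum_(j < L) cabs2 (f (val i, val j)).
Proof.
move=> f0; rewrite /l2dom /l2norm /= (l2sq_finite f0) ltry; split=> //=.
by rewrite sqr_sqrtr // !sumr_ge0 // => i _; rewrite sumr_ge0 // => j _;
  exact: cabs2_ge0.
Qed.

(** Homogeneity, with [w] in the role of a squared scalar: a bound over the unit ball yields an
    inequality for all arrays. *)
Lemma le_of_scaled_le (A B Y : R) : 0 <= B -> 0 <= Y ->
  (forall w, 0 <= w -> w * Y <= 1 -> w * A <= B) -> A <= B * Y.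
Proof.
move=> B0 Y0 h; have [Y00|Yn0] := eqVneq Y 0.
  rewrite Y00 mulr0 leNgt; apply/negP => A0.
  (* With [Y = 0] every scale is allowed, and this one turns the bound into [B + 1 <= B]. *)
  have := h ((B + 1) / A); rewrite divr_ge0 ?addr_ge0 ?(ltW A0) // => /(_ isT).
  rewrite Y00 mulr0 ler01 divfK ?gt_eqF // => /(_ isT).
  by rewrite gerDl ler10.
have Yp : 0 < Y by rewrite lt_def Yn0.
by rewrite mulrC -ler_pdivrMl //; apply: h; rewrite ?invr_ge0 // mulVf.
Qed.

Lemma mxopnorm_shifts_ge0 k (P : 'I_k -> 'I_k -> {poly {poly C}}) :
  (0 <= mxopnorm (@l2norm R) (@l2dom R) P (@shiftI R) (@shift2 R))%E.
Proof.
have [dom0 norm0] := @l2norm_finite 0 0 (fun _ _ _ => erefl).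
apply: le_trans; last first.
  apply: ereal_sup_ubound; exists (fun=> 0) => //; split=> // .
  by rewrite big1 // => s _; rewrite norm0 big_ord0.
by rewrite lee_fin sqrtr_ge0.
Qed.

Variables (k d : nat) (P : 'I_k -> 'I_k -> {poly {poly C}}).
Hypothesis sizeP : forall r s, (size (P r s) <= d)%N.
Hypothesis size_coefP : forall r s i, (size ((P r s)`_i)%R <= d)%N.
Variable nP : R.
Hypothesis mxnormP :
  mxopnorm (@l2norm R) (@l2dom R) P (@shiftI R) (@shift2 R) = nP%:E.

Let cf r s i j := ((P r s)`_i)`_j.
Let conv M (c : nat -> nat -> 'I_k -> C) : R :=
  \sum_(r < k) \sum_(u < M) \sum_(v < M)
    cabs2 (\sum_(s < k) \sum_(i < d) \sum_(j < d)
      cf r s i j * c (u + i)%N (v + j)%N s).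
Let mass N (c : nat -> nat -> 'I_k -> C) : R :=
  \sum_(u < N) \sum_(v < N) \sum_(s < k) cabs2 (c u v s).

Let nP_ge0 : 0 <= nP.
Proof. by rewrite -lee_fin -mxnormP mxopnorm_shifts_ge0. Qed.

(** The values counted by [conv M c] are among the coefficients of the shift matrix applied to a
    tuple of norm at most 1. *)
Lemma conv_unit_bound M c : mass (M + d) c <= 1 -> conv M c <= nP ^+ 2.
Proof.
move=> mass1; set N := (M + d)%N.
have revK m n : (m < n)%N -> (n - m.+1 < n)%N /\ (n - (n - m.+1).+1 = m)%N.
  by lia.
have shiftK u i : (u < M)%N -> (i < d)%N -> [/\ (i <= N - u.+1)%N,
    (N - u.+1 - i < N)%N & (N - (N - u.+1 - i).+1 = u + i)%N].
  by rewrite /N => uM id; split; lia.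
(* Reversing both indices turns the causal action of the shifts into the
   forward translations c (u + i) (v + j). *)
pose F s : L2 R := fun ij => if (ij.1 < N)%N && (ij.2 < N)%N
  then c (N - ij.1.+1)%N (N - ij.2.+1)%N s else 0.
have F0 s i j : (N <= i)%N || (N <= j)%N -> F s (i, j) = 0.
  by rewrite /F /=; case: ltnP => //= _; case: ltnP.
have FE s : l2norm (F s) ^+ 2 = \sum_(u < N) \sum_(v < N) cabs2 (c u v s).
  rewrite (l2norm_finite (F0 s)).2 (reindex_inj rev_ord_inj) /=.
  apply: eq_bigr => u _; rewrite (reindex_inj rev_ord_inj) /=.
  apply: eq_bigr => v _.
  have [ult uE] := revK _ _ (ltn_ord u); have [vlt vE] := revK _ _ (ltn_ord v).
  by rewrite /F /= ult vlt uE vE.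
pose g r := \sum_(s < k) peval2 (P r s) (@shiftI R) (@shift2 R) (F s).
have gE r a b : g r (a, b) = \sum_(s < k) \sum_(i < d) \sum_(j < d)
    cf r s i j * if (i <= a)%N && (j <= b)%N then F s (a - i, b - j)%N else 0.
  rewrite /g fct_sumE; apply: eq_bigr => s _; rewrite (peval2_widen _ _ _ (sizeP r s)) //.
  rewrite fct_sumE; apply: eq_bigr => i _; rewrite fct_sumE; apply: eq_bigr => j _.
  by rewrite -iter_shift.
(* Shifts by less than [d] move a support below [N] to one below [N + d]. *)
have g0 r i j : (N + d <= i)%N || (N + d <= j)%N -> g r (i, j) = 0.
  move=> hij; rewrite gE big1 // => s _; rewrite big1 // => i' _; rewrite big1 // => j' _.
  case: ifP => _; rewrite ?mulr0 // F0 ?mulr0 //.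
  by have := ltn_ord i'; have := ltn_ord j'; lia.
have gN : \sum_(r < k) l2norm (g r) ^+ 2 <= nP ^+ 2.
  rewrite -[leLHS]sqr_sqrtr; last by rewrite sumr_ge0 // => r _; exact: sqr_ge0.
  rewrite ler_sqr ?nnegrE ?sqrtr_ge0 ?nP_ge0 // -lee_fin -mxnormP.
  apply: ereal_sup_ubound; exists F => //; split=> [s|].
    exact: (l2norm_finite (F0 s)).1.
  under eq_bigr => s _ do rewrite FE.
  rewrite exchange_big; apply: le_trans mass1; rewrite le_eqVlt; apply/orP; left.
  by apply/eqP/eq_bigr => u _; rewrite exchange_big.
apply: le_trans gN; apply: ler_sum => r _; rewrite (l2norm_finite (g0 r)).2.
(* For [u, v < M] the reversed positions are at least [d], so the tests [i <= a] and [j <= b] never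
   cut a term. *)
have gu (u v : 'I_M) : \sum_(s < k) \sum_(i < d) \sum_(j < d)
    cf r s i j * c (u + i)%N (v + j)%N s = g r (N - u.+1, N - v.+1)%N.
  rewrite gE; apply: eq_bigr => s _; apply: eq_bigr => i _; apply: eq_bigr => j _.
  have [iu uilt uiE] := shiftK _ _ (ltn_ord u) (ltn_ord i).
  have [jv vjlt vjE] := shiftK _ _ (ltn_ord v) (ltn_ord j).
  by rewrite iu jv /F /= uilt vjlt uiE vjE.
under eq_bigr => u _ do under eq_bigr => v _ do rewrite gu.
(* Coefficients outside the reversed window are discarded, in the second index and then in the
   first. *)
apply: (@le_trans _ _ (\sum_(u < M) \sum_(b < N + d) cabs2 (g r (N - u.+1, val b)%N))).
  apply: ler_sum => u _.
  apply: (@sum_rev_le R (fun b => cabs2 (g r (N - u.+1, b)%N))) => [|i]; first lia.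
  exact: cabs2_ge0.
apply: (@sum_rev_le R (fun a => \sum_(b < N + d) cabs2 (g r (a, val b)))) => [|i].
  lia.
by rewrite sumr_ge0 // => b _; exact: cabs2_ge0.
Qed.

Lemma conv_bound M c : conv M c <= nP ^+ 2 * mass (M + d) c.
Proof.
apply: le_of_scaled_le => [||w w0 wY]; first exact: sqr_ge0.
  rewrite sumr_ge0 // => u _; rewrite sumr_ge0 // => v _.
  by rewrite sumr_ge0 // => s _; exact: cabs2_ge0.
pose t := (Num.sqrt w)%:C%C : C.
have tw : cabs2 t = w by rewrite /cabs2 /= expr0n addr0 sqr_sqrtr.
have massE : w * mass (M + d) c = mass (M + d) (fun u v s => t * c u v s).
  rewrite !mulr_sumr; apply: eq_bigr => u _; rewrite mulr_sumr; apply: eq_bigr => v _.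
  by rewrite mulr_sumr; apply: eq_bigr => s _; rewrite cabs2M tw.
have convE : w * conv M c = conv M (fun u v s => t * c u v s).
  rewrite !mulr_sumr; apply: eq_bigr => r _; rewrite !mulr_sumr.
  apply: eq_bigr => u _; rewrite mulr_sumr; apply: eq_bigr => v _.
  rewrite -tw -cabs2M !mulr_sumr; congr cabs2; apply: eq_bigr => s _.
  rewrite mulr_sumr; apply: eq_bigr => i _; rewrite mulr_sumr.
  by apply: eq_bigr => j _; rewrite mulrCA.
by rewrite convE; apply: conv_unit_bound; rewrite -massE.
Qed.

Lemma conv_boundC M (c : nat -> nat -> 'I_k -> C) :
  \sum_(r < k) \sum_(u < M) \sum_(v < M)
    `|\sum_(t : 'I_k * 'I_d * 'I_d)
       cf r t.1.1 t.1.2 t.2 * c (u + t.1.2)%N (v + t.2)%N t.1.1| ^+ 2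
  <= (nP ^+ 2)%:C%C *
     \sum_(u < M + d) \sum_(v < M + d) \sum_(s < k) `|c u v s| ^+ 2.
Proof.
have -> : \sum_(u < M + d) \sum_(v < M + d) \sum_(s < k) `|c u v s| ^+ 2 =
    (mass (M + d) c)%:C%C.
  rewrite rmorph_sum; apply: eq_bigr => u _; rewrite rmorph_sum.
  apply: eq_bigr => v _; rewrite rmorph_sum; apply: eq_bigr => s _.
  by rewrite normC_cabs2.
rewrite -rmorphM [leLHS](_ : _ = (conv M c)%:C%C) ?lecR ?conv_bound //.
rewrite rmorph_sum; apply: eq_bigr => r _; rewrite rmorph_sum.
apply: eq_bigr => u _; rewrite rmorph_sum; apply: eq_bigr => v _.
rewrite normC_cabs2; congr (cabs2 _)%:C%C.
exact: (sum_triple (fun s (i j : 'I_d) => cf r s i j * c (u + i)%N (v + j)%N s)).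
Qed.

End ScalarBound.

(** * From windows to the inequality of operator norms *)

Theorem mainTheorem20 (R : realType) :
  exists Phi : L2 R -> L2 R,
    l2_isometry Phi /\
    (forall f, l2dom f -> Phi (shiftI f) = shiftI (Phi f)) /\
    (forall (V : lmodType R[i]) (ip : V -> V -> R[i]),
       hilbert_inner ip ->
       forall T1 T2 : V -> V,
         op_contraction ip T1 -> op_contraction ip T2 -> T1 \o T2 = T2 \o T1 ->
         forall (k : nat) (P : 'I_k -> 'I_k -> {poly {poly R[i]}}),
           (mxopnorm (ip_norm ip) setT P T1 T2
             <= mxopnorm (@l2norm R) (@l2dom R) P (@shiftI R) Phi)%E).
Proof.
exists (@shift2 R); split; first exact: shift2_isometry.
split=> [f _|V ip hip T1 T2 [lT1 cT1] [lT2 cT2] T12 k P].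
  exact: shift2_shiftI.
have hf : semi_inner ip by case: hip => h1 h2 h3 _ _; split.
have ipE x : ip x x = (ip_norm ip x ^+ 2)%:C%C.
  have := ip_ge0 hf x; rewrite /ip_norm; case: (ip x x) => a b.
  by rewrite lecE /= => /andP[/eqP -> a0]; rewrite sqr_sqrtr.
have ipT T : (forall x, ip_norm ip (T x) <= ip_norm ip x) ->
    forall x, ip (T x) (T x) <= ip x x.
  by move=> cT x; rewrite !ipE lecR lerXn2r ?nnegrE ?sqrtr_ge0.
have T12' x : T1 (T2 x) = T2 (T1 x) by exact: (congr1 (@^~ x) T12).
apply: ge_ereal_sup => _ [x [_ x1] <-].
(* One bound for the sizes of all entries in both variables. *)
pose d := \max_(rs : 'I_k * 'I_k) maxn (size (P rs.1 rs.2))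
  (\max_(i < size (P rs.1 rs.2)) size ((P rs.1 rs.2)`_i)%R).
have dP r s : (size (P r s) <= d)%N.
  by apply: leq_trans (leq_bigmax (r, s)); exact: leq_maxl.
have dcP r s i : (size ((P r s)`_i)%R <= d)%N.
  have [iP|iP] := ltnP i (size (P r s)); last by rewrite nth_default // size_poly0.
  apply: leq_trans (leq_bigmax (r, s)); apply: leq_trans (leq_maxr _ _).
  exact: (leq_bigmax (Ordinal iP)).
(* An infinite norm on the right makes the inequality trivial, and [-oo] is excluded by testing the
   zero tuple. *)
case nP : (mxopnorm (@l2norm R) _ P _ _) => [c| |]; last 2 first.
- exact: leey.
- by have := mxopnorm_shifts_ge0 P; rewrite nP.
have c0 : 0 <= c by rewrite -lee_fin -nP mxopnorm_shifts_ge0.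
pose cf r s i j := ((P r s)`_i)`_j.
pose X r := \sum_(s < k) peval2 (P r s) T1 T2 (x s).
have XE r : X r = @coef_eval _ k d cf V T1 T2 x r.
  rewrite /coef_eval (sum_triple
    (fun s (i j : 'I_d) => cf r s i j *: iter i T1 (iter j T2 (x s)))).
  by apply: eq_bigr => s _; exact: peval2_widen.
have Xc : \sum_(r < k) ip_norm ip (X r) ^+ 2 <=
    c ^+ 2 * \sum_(s < k) ip_norm ip (x s) ^+ 2.
  (* The window inequality holds for every [M] with the same [d], so the boundary factor disappears
     in the limit. *)
  apply: (@growth_limit _ _ _ d) => [|M].
    by rewrite mulr_ge0 ?sqr_ge0 // sumr_ge0 // => s _; exact: sqr_ge0.
  have sumE (y : 'I_k -> V) : (\sum_(s < k) ip_norm ip (y s) ^+ 2)%:C%C =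
      \sum_(s < k) ip (y s) (y s).
    by rewrite rmorph_sum; apply: eq_bigr => s _; rewrite ipE.
  have castE n (A : R) : (n%:R ^+ 2 * A)%:C%C = n%:R ^+ 2 * A%:C%C.
    by rewrite rmorphM rmorphXn rmorph_nat.
  rewrite -lecR !castE rmorphM /= !sumE.
  under eq_bigr => r _ do rewrite XE.
  exact: (contraction_bound (conv_boundC dP dcP nP) _ _ hf lT1 lT2 (ipT _ cT1)
    (ipT _ cT2) T12').
rewrite lee_fin -[leRHS]ger0_norm // -sqrtr_sqr ler_wsqrtr //.
by apply: le_trans Xc _; rewrite ler_piMr ?sqr_ge0.
Qed.
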